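(* Let $X$ be a Tychonoff space whose universal quasi-uniformity $q\mathcal U_X$ has an $\omega^\omega$-base. Then: (1) the universal uniformity $\mathcal U_X$ of $X$ has an $\omega^\omega$-base; (2) the set $X^{\prime\mathsf s}$ is countable and closed in $X$; (3) if $\omega_1<\mathfrak b$, then the set $X^{\prime P}$ is countable and closed in $X$.
   Context: $\omega^\omega$ carries the coordinatewise order; $\mathfrak b$ is the smallest cardinality of a subset of $\omega^\omega$ unbounded with respect to $\le^*$, where $f\le^*g$ iff $f(n)\le g(n)$ for all but finitely many $n$. A neighborhood assignment on $X$ is a set $U\subset X\times X$ such that for every $x$ the set $U[x]=\{y:(x,y)\in U\}$ is a neighborhood of $x$. For relations, $UV=\{(x,z):\exists y\ (x,y)\in U,\ (y,z)\in V\}$. The universal quasi-uniformity $q\mathcal U_X$ is the filter on $X\times X$ with base consisting of the sets $\bigotimes_{n\in\omega}U_n=\bigcup_{n\in\omega}\bigcup_{\sigma\in S_n}U_{\sigma(0)}\cdots U_{\sigma(n-1)}$, where $(U_n)_{n\in\omega}$ runs over sequences of neighborhood assignments on $X$ and $S_n$ is the group of permutations of $\{0,\dots,n-1\}$ (equivalently, the largest quasi-uniformity consisting of neighborhood assignments). The universal uniformity $\mathcal U_X$ is the uniformity with base $\{(x,y):d(x,y)<1\}$, where $d$ runs over all continuous pseudometrics on $X$. A filter $\mathcal U$ on $X\times X$ has an $\omega^\omega$-base if it has a base $(U_\alpha)_{\alpha\in\omega^\omega}$ with $U_\beta\subset U_\alpha$ for all $\alpha\le\beta$. $X^{\prime\mathsf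 s}$ is the set of points $x\in X$ for which there is a countable set $C\subset X$ such that every neighborhood of $x$ contains infinitely many points of $C$. $X^{\prime P}$ is the set of points $x\in X$ that are not $P$-points, where $x$ is a $P$-point if the intersection of any countably many neighborhoods of $x$ is a neighborhood of $x$. *)

(* Defs.v *)
From HB Require Import structures.
From mathcomp Require Import all_boot all_order all_algebra all_fingroup.
From mathcomp Require Import all_classical all_reals all_analysis.

Set Implicit Arguments.
Unset Strict Implicit.
Unset Printing Implicit Defensive.

Import Order.TTheory GRing.Theory Num.Theory.
Import numFieldNormedType.Exports.

Local Open Scope classical_set_scope.
Local Open Scope card_scope.

(* Cardinals are represented by sets of minimal cardinality among the sets
   having some property; [least_card_exists] says that the minimum is always
   attained. *)

Definition least_card {T : Type} (P : set (set T)) (A : set T) : Prop :=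
  P A /\ forall B, P B -> A #<= B.

Definition card_lt {T U : Type} (A : set T) (B : set U) : Prop :=
  A #<= B /\ ~ (B #<= A).

Lemma least_card_exists {T : Type} (P : set (set T)) :
  P !=set0 -> exists A, least_card P A.
Proof.
move=> [A0 PA0].
(* a maximal set of selectors of P that pairwise differ at every set of P *)
pose good (F : set (set T -> T)) :=
  (forall g, F g -> forall B, P B -> B (g B)) /\
  (forall g h, F g -> F h -> forall B, P B -> g B = h B -> g = h).
have [F [[Fsel Finj] Fmax]] : exists F, good F /\ forall G, F `<` G -> ~ good G.
  apply: Zorn_bigcup => C Cgood Ctot; split.
    by move=> g [F CF Fg]; have [+ _] := Cgood _ CF; apply.
  move=> g h [F CF Fg] [G CG Gh].
  have [FG|GF] := Ctot _ _ CF CG.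
    by have [_] := Cgood _ CG; apply=> //; exact: FG.
  by have [_] := Cgood _ CF; apply=> //; exact: GF.
have [A PA AF] : exists2 A, P A & A `<=` (fun g => g A) @` F.
  apply: contrapT => nA.
  have pick B : exists b, P B -> B b /\ ~ ((fun g => g B) @` F) b.
    have [PB|] := pselect (P B); last first.
      have [[b _] nPB|A00] := pselect (A0 !=set0); first by exists b.
      by exfalso; apply: nA; exists A0 => // x A0x; case: A00; exists x.
    apply: contrapT => nb; apply: nA; exists B => // b Bb.
    by apply: contrapT => Fb; apply: nb; exists b.
  have [k kP] := choice pick.
  have kF B g : P B -> F g -> k B <> g B.
    by move=> PB Fg kg; have [_] := kP _ PB; apply; exists g.
  refine (Fmax (F `|` [set k]) _ _).
    split; first by move=> g Fg; left.
    move=> sub; have Fk : F k by apply: sub; right.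
    exact: (kF A0 k PA0 Fk).
  split=> [g [Fg|->] B PB|g h [Fg|->] [Fh|->] B PB //].
  - exact: (Fsel _ Fg _ PB).
  - by have [] := kP _ PB.
  - exact: (Finj _ _ Fg Fh _ PB).
  - by move=> gk; case: (kF _ _ PB Fg).
  - by move=> kh; case: (kF _ _ PB Fh).
exists A; split=> // B PB.
apply: (card_le_trans (subset_card_le AF)).
apply: (card_le_trans (card_image_le _ _)).
have injB : {in F &, injective (fun g : set T -> T => g B)}.
  by move=> g h; rewrite !inE => Fg Fh; exact: (Finj _ _ Fg Fh _ PB).
rewrite -(card_le_eql (inj_card_eq injB)).
by apply: subset_card_le => _ [g Fg <-]; exact: (Fsel _ Fg _ PB).
Qed.

Definition le_star (f g : nat -> nat) : Prop :=
  \forall n \near \oo, (f n <= g n)%N.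

Definition star_unbounded (B : set (nat -> nat)) : Prop :=
  ~ exists g, forall f, B f -> le_star f g.

Definition frakb : set (nat -> nat) := get (least_card star_unbounded).

(* omega_1 as the least uncountable cardinal *)
Definition omega1 : set (nat -> nat) :=
  get (least_card [set W : set (nat -> nat) | ~ countable W]).

Lemma frakbP : least_card star_unbounded frakb.
Proof.
apply: (@getPex _ (least_card star_unbounded)).
apply: least_card_exists; exists setT => -[g].
move=> /(_ (fun n => (g n).+1) I) [N _ /(_ N)] /=.
by rewrite leqnn ltnn => /(_ isT).
Qed.

Lemma omega1P :
  least_card [set W : set (nat -> nat) | ~ countable W] omega1.
Proof.
apply: (@getPex _ (least_card [set W : set (nat -> nat) | ~ countable W])).
apply: least_card_exists; exists setT => /= /countable_injP[e einj].
pose h n := xget (fun=> 0%N) [set f | e f = n].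
pose d n := (h n n).+1.
have : h (e d) = d.
  apply: einj; rewrite ?inE//.
  exact: (@xgetPex _ _ [set f | e f = e d] (ex_intro _ d erefl)).
by move=> /(congr1 (fun f => f (e d))); rewrite {2}/d => /n_Sn.
Qed.

Definition has_omega_omega_base {T : Type} (F : set_system T) : Prop :=
  exists U : (nat -> nat) -> set T,
    [/\ forall alpha, F (U alpha),
        forall A, F A -> exists alpha, U alpha `<=` A
      & forall alpha beta, (forall n, (alpha n <= beta n)%N) ->
          U beta `<=` U alpha].

(* The notation \; composes right to left, whereas U V is "first U, then V". *)
Definition rel_mul {X : Type} (U V : set (X * X)) : set (X * X) :=
  (V \; U)%relation.

Definition rel_id {X : Type} : set (X * X) := [set xy | xy.1 = xy.2].

Definition nbhs_assignment {X : topologicalType} (U : set (X * X)) : Prop :=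
  forall x, nbhs x (xsection U x).

(* The term n = 0 is the empty product, i.e. the diagonal. *)
Definition perm_prod {X : Type} (U : nat -> set (X * X)) : set (X * X) :=
  \bigcup_n \bigcup_(s in [set: 'S_n])
    \big[rel_mul/rel_id]_(i < n) U (s i).

Definition universal_quasi_uniformity (X : topologicalType) :
    set_system (X * X) :=
  filter_from
    [set U : nat -> set (X * X) | forall n, nbhs_assignment (U n)] perm_prod.
Arguments universal_quasi_uniformity : clear implicits.

Definition continuous_pseudometric {R : realType} {X : topologicalType}
    (d : X * X -> R) : Prop :=
  [/\ forall x y, (0 <= d (x, y))%R,
      forall x, d (x, x) = 0%R,
      forall x y, d (x, y) = d (y, x),
      forall x y z, (d (x, z) <= d (x, y) + d (y, z))%R
    & continuous d].

Definition universal_uniformity (R : realType) (X : topologicalType) :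
    set_system (X * X) :=
  filter_from (@continuous_pseudometric R X) (fun d => [set xy | (d xy < 1)%R]).
Arguments universal_uniformity : clear implicits.

(* [uniform_separatorP] unfolds complete regularity to the separation of points
   from closed sets by continuous functions into [0, 1]. *)
Definition tychonoff_space (X : topologicalType) : Prop :=
  completely_regular_space X /\ hausdorff_space X.

(* The set written X'^s *)
Definition countable_accumulation (X : topologicalType) : set X :=
  [set x | exists C : set X, countable C /\
    forall V, nbhs x V -> infinite_set (V `&` C)].
Arguments countable_accumulation : clear implicits.

Definition P_point {X : topologicalType} (x : X) : Prop :=
  forall V : nat -> set X, (forall n, nbhs x (V n)) -> nbhs x (\bigcap_n V n).

(* The set written X'^P *)
Definition non_P_points (X : topologicalType) : set X :=
  [set x | ~ P_point x].
Arguments non_P_points : clear implicits.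

(* Main.v *)
Require Import Defs.
From mathcomp Require Import all_boot all_order all_algebra all_fingroup.
From mathcomp Require Import all_classical all_reals all_analysis.
From mathcomp Require Import ring lra.

Set Implicit Arguments.
Unset Strict Implicit.
Unset Printing Implicit Defensive.

Import Order.TTheory GRing.Theory Num.Theory.
Import numFieldNormedType.Exports.

Local Open Scope classical_set_scope.

(** Fix a base (U_a) of the universal quasi-uniformity indexed by functions
    a : nat -> nat.

    Countability of derived sets.  Two facts about the index set do the work.
    Functions b_n that agree with a on n values are bounded by one function
    [extending_bounded]; hence, if no U_b avoids all of countably many
    obstacles, some finite prefix s of a has an obstacle that no U_b with b
    extending s avoids [prefix_avoids].  And there are only countably many
    finite prefixes.  So let A be an uncountable set of points, and let A_s
    consist of the points x having an obstacle that is met by U_b[x] for all b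
    extending s.  For each a the set A is the union of the A_s, s a prefix of
    a, so A_s is uncountable for one of them.  If V in the quasi-uniformity
    avoids, for each s with A_s uncountable, such an obstacle at one point of
    A_s, then no U_a is contained in V: a contradiction.  Since V need only
    handle countably many points, it can be built by hand.  The relations used
    are transitive [same_forward]; transitivity makes membership in the
    quasi-uniformity immediate.

    - For the closure of a countable set D [countable_closure] the obstacles are
      the points of D; there a sequence approximating a point x with respect to
      countably many sets, refinements of the A_s, replaces the relation V.
    - For X'^s the obstacle at x is a point c <> x, and V keeps points outside
      the members of a sequence of countable closed sets from entering them.
      The union of that sequence must be closed for V to be a neighborhood
      assignment; a cofinality argument [cofinal_prefixes] chooses the sequence
      so that its indices are bounded.
    - For X'^P the obstacles at x are countably many neighborhoods of x whose
      intersection is not a neighborhood, and U_b[x] avoids one of them if it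
      is contained in it.  The points can be chosen outside X'^s, which is
      already known to be countable, so they form a closed discrete set and have
      disjoint neighborhoods, from which V is made.

    Closedness follows from countability: a point of the closure of X'^s that
    is not in X'^s would be an accumulation point of the countable set X'^s,
    and a P-point outside a countable set has a neighborhood disjoint from it.

    Universal uniformity.  If all S_n are symmetric neighborhood assignments,
    their permutation product contains a ball of a continuous pseudometric
    [symmetric_perm_prod], and every ball of a continuous pseudometric contains
    the permutation product of smaller balls [pseudometric_perm_prod].  So the
    products of the symmetrized U_(a_n) form a base, and a sequence (a_n) is
    coded by one function. *)

(** * Functions extending a finite prefix *)
Definition extends (s : seq nat) (b : nat -> nat) : Prop :=
  forall i, (i < size s)%N -> b i = nth 0%N s i.

Definition decode_prefix (n : nat) : seq nat := odflt [::] (unpickle n).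

Lemma decode_prefixK (s : seq nat) : decode_prefix (pickle s) = s.
Proof. by rewrite /decode_prefix pickleK. Qed.

Definition le_pt (a b : nat -> nat) : Prop := forall i, (a i <= b i)%N.

Lemma extends_mkseq a n b :
  extends (mkseq a n) b <-> forall i, (i < n)%N -> b i = a i.
Proof.
rewrite /extends size_mkseq.
by split=> E i lin; rewrite E// nth_mkseq.
Qed.

Lemma extends_self a n : extends (mkseq a n) a.
Proof. exact/extends_mkseq. Qed.
Arguments extends_self : clear implicits.

(** At each argument only finitely many b_n can differ from a. *)
Lemma extending_bounded (a : nat -> nat) (b : nat -> nat -> nat) :
  (forall n, extends (mkseq a n) (b n)) -> exists c, forall n, le_pt (b n) c.
Proof.
move=> ab; exists (fun i => a i + \sum_(n < i.+1) b n i)%N => n i.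
have [lin|lni] := ltnP i n; last first.
  by rewrite (bigD1 (inord n)) //= inordK ?ltnS// addnCA leq_addr.
by rewrite (extends_mkseq a n (b n)).1 ?leq_addr//; exact: ab.
Qed.

(** Otherwise pick b_n in Q_n extending the n-th prefix of a; a bound of all b_n
    is in every Q_n. *)
Lemma prefix_avoids (Q : nat -> set (nat -> nat)) :
  (forall n b c, le_pt b c -> Q n b -> Q n c) -> ~ (exists b, forall n, Q n b) ->
  forall a, exists n, forall b, extends (mkseq a n) b -> ~ Q n b.
Proof.
move=> Qup Q0 a; apply: contrapT => /forallNP nQ.
have /choice[b bP] : forall n, exists b, extends (mkseq a n) b /\ Q n b.
  move=> n; have /existsNP[b bE] := nQ n.
  by exists b; have [ab /contrapT Qb] := (not_implyP _ _).1 bE.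
have [c bc] := extending_bounded (fun n => (bP n).1).
by apply: Q0; exists c => n; apply: Qup (bc n) (bP n).2.
Qed.

(** * Selecting points of uncountable sets *)
Lemma uncountable_prefix {T : Type} (A : set T) (B : seq nat -> set T) a :
  ~ countable A -> (forall x, A x -> exists n, B (mkseq a n) x) ->
  exists n, ~ countable (A `&` B (mkseq a n)).
Proof.
move=> Auc AB; apply: contrapT => /forallNP cB; apply: Auc.
apply: sub_countable (bigcup_countable (I := nat) (D := setT) _ _); last 2 first.
- exact: countableP.
- by move=> n _; exact: contrapT (cB n).
by apply: subset_card_le => x Ax; have [n Bx] := AB x Ax; exists n.
Qed.

Lemma uncountable_setD {T : Type} (A B : set T) :
  ~ countable A -> countable B -> exists2 x, A x & ~ B x.
Proof.
move=> Auc Bc; apply: contrapT => /forall2NP AB; apply: Auc.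
apply: sub_countable Bc; apply: subset_card_le => x Ax.
by have [//|/contrapT] := AB x.
Qed.

Lemma countable_setU {T : Type} (A B : set T) :
  countable A -> countable B -> countable (A `|` B).
Proof.
move=> Ac Bc; rewrite -bigcup2E; apply: bigcup_countable; first exact: countableP.
by move=> [|[|i]].
Qed.

(** Remove from K every finite intersection of the sets S_i that meets K in a
    countable set.  At a point x that is left, each finite intersection
    containing x has points of K other than x. *)
Lemma condensation {I : countType} {T : Type} (K : set T) (S : I -> set T) :
  ~ countable K ->
  exists2 x, K x & exists u : nat -> T,
    (forall n, K (u n) /\ u n <> x) /\
    forall i, S i x -> forall n, (pickle i <= n)%N -> S i (u n).
Proof.
move=> Kuc.
pose cap (l : seq I) := [set y | K y /\ forall i, i \in l -> S i y].
pose L := [set l | countable (cap l)].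
have [] := @uncountable_setD _ K (\bigcup_(l in L) cap l) Kuc.
  by apply: bigcup_countable => //; exact: countableP.
move=> x Kx Lx; exists x => //.
have /choice[u uP] : forall n, exists y, [/\ K y, y <> x &
    forall i, S i x -> (pickle i <= n)%N -> S i y].
  move=> n.
  (* the finitely many indices with code at most n whose set contains x *)
  pose l := [seq i <- pmap unpickle (iota 0 n.+1) | `[< S i x >]].
  have [|y [Ky Sy] yx] := @uncountable_setD _ (cap l) [set x] _ (countable1 x).
    move=> lc; apply: Lx; exists l => //; split=> // i.
    by rewrite mem_filter => /andP[/asboolP].
  exists y; split=> // i Six lin; apply: Sy; rewrite mem_filter.
  apply/andP; split; first exact/asboolP.
  rewrite mem_pmap; apply/mapP; exists (pickle i); last by rewrite pickleK.
  by rewrite mem_iota ltnS.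
exists u; split=> [n|i Six n]; first by have [] := uP n.
by have [_ _] := uP n; apply.
Qed.

Lemma injective_choice {T : eqType} (B : nat -> set T) :
  (forall n, ~ countable (B n)) ->
  exists2 x : nat -> T, injective x & forall n, B n (x n).
Proof.
move=> Buc.
have /choice[f fP] : forall l : seq T, exists y, B (size l) y /\ y \notin l.
  move=> l; have [|y By yl] := @uncountable_setD _ _ [set` l] (Buc (size l)).
    by apply: finite_set_countable; exact: finite_seq.
  by exists y; split=> //; exact/negP.
pose h := fix h n := if n is m.+1 then f (h m) :: h m else [::].
have sz n : size (h n) = n by elim: n => //= n ->.
have hin m n : (m < n)%N -> f (h m) \in h n.
  elim: n => // n IH; rewrite ltnS leq_eqVlt inE => /orP[/eqP->|/IH ->].
    by rewrite eqxx.
  by rewrite orbT.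
exists (fun n => f (h n)) => [m n /= E|n]; last first.
  by have [] := fP (h n); rewrite sz.
have [lt|lt|//] := ltngtP m n.
  by have [_] := fP (h n); rewrite -E hin.
by have [_] := fP (h m); rewrite E hin.
Qed.

(** For each prefix s that is not cofinal take a good set that no good set with
    index extending s contains.  A good set F0 containing all of them has only
    cofinal prefixes, because F0 itself extends them. *)
Lemma cofinal_prefixes {T : Type} (good : set (set T))
    (a : set T -> nat -> nat) : good set0 ->
  (forall W : seq nat -> set T, (forall s, good (W s)) ->
    exists2 F, good F & \bigcup_s W s `<=` F) ->
  exists F0, good F0 /\ forall n F, good F ->
    exists F', [/\ good F', F `<=` F' & extends (mkseq (a F0) n) (a F')].
Proof.
move=> good0 goodU.
pose cofinal s := forall F, good F ->
  exists F', [/\ good F', F `<=` F' & extends s (a F')].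
have /choice[W WP] : forall s, exists F, good F /\ (~ cofinal s ->
    forall F', good F' -> F `<=` F' -> ~ extends s (a F')).
  move=> s; have [sc|/existsNP[F nF]] := pselect (cofinal s).
    by exists set0.
  have [gF F'] := (not_implyP _ _).1 nF; exists F; split=> // _ F1 gF1 FF1 sF1.
  by apply: F'; exists F1.
have [F0 gF0 WF0] := goodU W (fun s => (WP s).1).
exists F0; split=> // n; apply: contrapT => ncof.
have [_ /(_ ncof _ gF0)] := WP (mkseq (a F0) n); apply; last exact: extends_self.
by apply: subset_trans WF0; exact: bigcup_sup.
Qed.

(** * Products of relations along a list of indices *)
Section relprod.
Context {X : Type}.
Implicit Types (U V : nat -> set (X * X)) (l : seq nat).

Definition relprod U l : set (X * X) := \big[rel_mul/rel_id]_(k <- l) U k.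

Lemma relprod_nil U x y : relprod U [::] (x, y) <-> x = y.
Proof. by rewrite /relprod big_nil. Qed.

Lemma relprod_cons U k l x y :
  relprod U (k :: l) (x, y) <-> exists2 z, U k (x, z) & relprod U l (z, y).
Proof. by rewrite /relprod big_cons. Qed.

Lemma relprod_cat U l1 l2 x y z :
  relprod U l1 (x, y) -> relprod U l2 (y, z) -> relprod U (l1 ++ l2) (x, z).
Proof.
elim: l1 x => [|k l1 IH] x; first by move=> /relprod_nil ->.
move=> /relprod_cons[t Uxt /IH ty] /ty tz.
by rewrite cat_cons; apply/relprod_cons; exists t.
Qed.

Lemma relprod_rev U l x y : (forall k a b, U k (a, b) -> U k (b, a)) ->
  relprod U l (x, y) -> relprod U (rev l) (y, x).
Proof.
move=> Usym; elim: l x => [|k l IH] x; first by move=> /relprod_nil ->; apply/relprod_nil.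
move=> /relprod_cons[z xz /IH zy]; rewrite rev_cons -cats1.
by apply: relprod_cat zy _; apply/relprod_cons; exists x; [exact: Usym|exact/relprod_nil].
Qed.

Lemma relprod_refl U l x : (forall k a, U k (a, a)) -> relprod U l (x, x).
Proof.
move=> Urefl; elim: l => [|k l IH]; first exact/relprod_nil.
by apply/relprod_cons; exists x.
Qed.

Lemma relprod_sub U V l :
  (forall k, k \in l -> U k `<=` V k) -> relprod U l `<=` relprod V l.
Proof.
elim: l => [|k l IH] UV [x y]; first by move=> /relprod_nil ->; apply/relprod_nil.
move=> /relprod_cons[z xz zy]; apply/relprod_cons; exists z.
  by apply: (UV k); rewrite ?mem_head.
by apply: IH zy => i il; apply: UV; rewrite inE il orbT.
Qed.

(** Products along lists are easier to split and to concatenate than products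
    over permutations. *)
Lemma perm_prodP U xy :
  perm_prod U xy <-> exists n l, perm_eq l (iota 0 n) /\ relprod U l xy.
Proof.
split=> [[n _ [s _ Us]]|[n [l [ln Ul]]]].
  exists n, [seq val (s i) | i <- index_enum 'I_n]; split.
    rewrite -(val_enum_ord n) map_comp; apply: perm_map.
    apply: uniq_perm.
    - by rewrite (map_inj_uniq (@perm_inj _ s)) index_enum_uniq.
    - exact: enum_uniq.
    move=> i; rewrite mem_enum; apply/mapP; exists (s^-1 i)%g; rewrite ?permKV//.
  by rewrite /relprod big_map.
have szl : size l == n by rewrite (perm_size ln) size_iota.
have szi : size (iota 0 n) == n by rewrite size_iota.
exists n => //.
have /(@tuple_permP _ _ _ (Tuple szi))[s sE] := ln.
exists s => //; move: Ul; rewrite /relprod.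
have -> : l = [seq val (s i) | i <- index_enum 'I_n].
  rewrite sE /= /index_enum -enumT; apply: eq_map => i.
  by rewrite (tnth_nth 0%N) /= nth_iota ?ltn_ord.
by rewrite big_map.
Qed.

Lemma perm_prod_sub U V :
  (forall n, U n `<=` V n) -> perm_prod U `<=` perm_prod V.
Proof.
move=> UV xy /perm_prodP[n [l [ln Ul]]]; apply/perm_prodP; exists n, l; split=> //.
by apply: relprod_sub Ul => k _; exact: UV.
Qed.

Lemma sub_perm_prod U : U 0%N `<=` perm_prod U.
Proof.
move=> [x y] Uxy; apply/perm_prodP; exists 1%N, [:: 0%N]; split=> //.
by apply/relprod_cons; exists y => //; exact/relprod_nil.
Qed.

(** Reflexivity allows the indices missing from l to be appended, which turns l
    into a permutation of an initial segment. *)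
Lemma relprod_perm_prod U l : (forall k a, U k (a, a)) -> uniq l ->
  relprod U l `<=` perm_prod U.
Proof.
move=> Urefl ul [x y] Ulxy.
pose n := (\max_(k <- l) k).+1.
pose m := [seq k <- iota 0 n | k \notin l].
apply/perm_prodP; exists n, (l ++ m); split; last first.
  by apply: relprod_cat Ulxy _; exact: relprod_refl.
apply: uniq_perm; rewrite ?iota_uniq//.
  rewrite cat_uniq ul filter_uniq ?iota_uniq// andbT.
  by apply/hasPn => k; rewrite mem_filter => /andP[].
move=> k; rewrite mem_cat mem_filter mem_iota; case: (boolP (k \in l)) => //= kl.
by rewrite add0n ltnS leq_bigmax_seq.
Qed.

End relprod.

(** * Elements of the universal quasi-uniformity *)
Section quasi_uniformity.
Context {X : topologicalType}.

Definition same_forward {I : Type} (O : I -> set X) : set (X * X) :=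
  [set yz | forall i, O i yz.1 -> O i yz.2].

(** The relation is transitive, so it contains its own permutation products. *)
Lemma same_forward_qU {I : Type} (O : I -> set X) :
  (forall y, nbhs y [set z | forall i, O i y -> O i z]) ->
  universal_quasi_uniformity X (same_forward O).
Proof.
move=> nO; exists (fun=> same_forward O) => /=.
  move=> _ y; rewrite xsectionE; exact: nO.
move=> [x y] /perm_prodP[n [l [_ +]]] i /=; elim: l x {n} => [|k l IH] x.
  by move=> /relprod_nil ->.
by move=> /relprod_cons[z /(_ i)/= xz /IH zy] /xz /zy.
Qed.

Lemma closed_qU (F : set X) : closed F ->
  universal_quasi_uniformity X (same_forward (fun _ : unit => ~` F)).
Proof.
move=> Fc; apply: same_forward_qU => y; have [Fy|Fy] := pselect (F y).
  by apply: filterS filterT => z _ [].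
apply: filterS (open_nbhs_nbhs (conj (closed_openC Fc) Fy)) => z Fz [] _ //.
Qed.

(** A point y of the union lies in a least G n; the sets avoiding y are then the
    G i with i < n, and the largest of them, if any, is closed.  The last
    hypothesis covers the points outside the union, where infinitely many of the
    sets have to be avoided. *)
Lemma closed_chain_qU (G : nat -> set X) :
  (forall n, closed (G n)) -> (forall m n, (m <= n)%N -> G m `<=` G n) ->
  (forall y, (forall n, ~ G n y) -> nbhs y [set z | forall n, ~ G n z]) ->
  universal_quasi_uniformity X (same_forward (fun n => ~` G n)).
Proof.
move=> Gc Gsub Gout; apply: same_forward_qU => y.
have [[n Gny]|/forallNP nGy] := pselect (exists n, G n y); last first.
  by apply: filterS (Gout y nGy) => z nGz n _; exact: nGz.
have exG : exists n, `[< G n y >] by exists n; exact/asboolP.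
case: (ex_minnP exG) => -[|m] /asboolP Gmy mmin.
  by apply: filterS filterT => z _ i /(_ (Gsub 0%N i (leq0n i) _ Gmy)).
have nGy : ~ G m y by move=> /asboolP /mmin; rewrite ltnn.
apply: filterS (open_nbhs_nbhs (conj (closed_openC (Gc m)) nGy)) => z nGz i nGi.
have [im|mi] := leqP i m; first by move=> /(Gsub _ _ im).
by case: nGi; exact: Gsub mi _ Gmy.
Qed.

Lemma qU_nbhs U x :
  universal_quasi_uniformity X U -> nbhs x [set y | U (x, y)].
Proof.
move=> [V Vn VU]; apply: filterS (Vn 0%N x) => y /xsectionP Vxy.
by apply: VU; exact: sub_perm_prod.
Qed.

End quasi_uniformity.

(** * A base of the universal uniformity *)

(** The pseudometric below is the length of the shortest chain, where a step in
    [block k] has length 1 / (k + 1).  In a chain of length less than 1 at most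
    k steps are in [block k], and [block k] is contained in enough of the S_n
    to give these steps different indices n.  So the chain is a product of S_n
    with distinct indices. *)
Section chain_pseudometric.
Local Open Scope ring_scope.
Context {R : realType} {X : topologicalType}.
Variable S : nat -> set (X * X).
Hypothesis S_nbhs : forall n x, nbhs x [set y | S n (x, y)].
Hypothesis S_sym : forall n x y, S n (x, y) -> S n (y, x).

Definition block (k : nat) : set (X * X) :=
  [set xy | forall j, (j <= k)%N -> S (pickle (k, j)) xy].

Definition weight (l : seq nat) : R := \sum_(k <- l) k.+1%:R^-1.

(** The value 1 is added so that the infimum is over a nonempty set when no
    chain joins x to y. *)
Definition chain_lengths (x y : X) : set R :=
  [set 1] `|` (weight @` [set l | relprod block l (x, y)]).

Definition chain_dist (xy : X * X) : R := inf (chain_lengths xy.1 xy.2).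

(** A step in [block k] receives the index coding (k, j), where j is the number
    of later steps in [block k]. *)
Fixpoint labels (l : seq nat) : seq nat :=
  if l is k :: l' then pickle (k, count_mem k l') :: labels l' else [::].

Lemma mem_labels l p : p \in labels l ->
  exists k j, p = pickle (k, j) /\ (j < count_mem k l)%N.
Proof.
elim: l => //= k l IH; rewrite inE => /orP[/eqP->|/IH[k' [j [-> jk]]]].
  by exists k, (count_mem k l); rewrite eqxx.
by exists k', j; split=> //; rewrite (leq_trans jk)// leq_addl.
Qed.

Lemma uniq_labels l : uniq (labels l).
Proof.
elim: l => //= k l ->; rewrite andbT; apply/negP => /mem_labels[k' [j [+ +]]].
by move=> /(pcan_inj pickleK)[-> ->]; rewrite ltnn.
Qed.

Lemma relprod_labels l : (forall k, (count_mem k l <= k.+1)%N) ->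
  relprod block l `<=` relprod S (labels l).
Proof.
elim: l => [|k l IH] lk [x y]; first by move=> /relprod_nil ->; exact/relprod_nil.
move=> /relprod_cons[z xz zy] /=; apply/relprod_cons; exists z.
  by apply: xz; have /= := lk k; rewrite eqxx.
by apply: IH zy => k'; apply: leq_trans (lk k'); rewrite /= leq_addl.
Qed.

Lemma weight_ge0 l : 0 <= weight l.
Proof. by apply: sumr_ge0 => k _; rewrite invr_ge0. Qed.

Lemma weight_count l k : (count_mem k l)%:R / k.+1%:R <= weight l.
Proof.
elim: l => [|k' l IH]; first by rewrite /= mul0r weight_ge0.
rewrite /weight big_cons /= natrD mulrDl lerD//.
by case: eqP => [->|_]; rewrite ?mul1r// mul0r invr_ge0.
Qed.

Lemma weight_lt1_perm_prod l : weight l < 1 -> relprod block l `<=` perm_prod S.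
Proof.
move=> l1 [x y] /relprod_labels lxy.
apply: (relprod_perm_prod (l := labels l)); first 2 last.
- apply: lxy => k; rewrite ltnW// -(ltr_nat R) -[ltRHS]mul1r -ltr_pdivrMr//.
  exact: le_lt_trans (weight_count l k) l1.
- by move=> k a; exact: nbhs_singleton (S_nbhs k a).
- exact: uniq_labels.
Qed.

Lemma chain_lengths_ge0 x y : lbound (chain_lengths x y) 0.
Proof. by move=> _ [->|[l _ <-]] //; exact: weight_ge0. Qed.

Lemma chain_lengths_neq0 x y : chain_lengths x y !=set0.
Proof. by exists 1; left. Qed.

Lemma chain_dist_le x y a : chain_lengths x y a -> chain_dist (x, y) <= a.
Proof.
by move=> xya; apply: ge_inf => //; exists 0; exact: chain_lengths_ge0.
Qed.

Lemma chain_dist_ge0 x y : 0 <= chain_dist (x, y).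
Proof. exact: (lb_le_inf (chain_lengths_neq0 _ _) (chain_lengths_ge0 (y := y))). Qed.

Lemma chain_dist_sym x y : chain_dist (x, y) = chain_dist (y, x).
Proof.
suff le a b : chain_dist (a, b) <= chain_dist (b, a) by apply/eqP; rewrite eq_le !le.
apply: lb_le_inf; first exact: chain_lengths_neq0.
move=> _ [->|[l lba <-]]; first by apply: chain_dist_le; left.
apply: chain_dist_le; right; exists (rev l).
  by apply: relprod_rev lba => k c d cd j jk; exact/S_sym/cd.
by rewrite /weight; apply: perm_big; rewrite perm_rev.
Qed.

Lemma chain_dist_triangle x y z :
  chain_dist (x, z) <= chain_dist (x, y) + chain_dist (y, z).
Proof.
have dle1 : chain_dist (x, z) <= 1 by apply: chain_dist_le; left.
rewrite -lerBlDr; apply: lb_le_inf; first exact: chain_lengths_neq0.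
move=> a xya; rewrite lerBlDr -lerBlDl.
apply: lb_le_inf; first exact: chain_lengths_neq0.
move=> b yzb; rewrite lerBlDl.
have a0 := chain_lengths_ge0 xya; have b0 := chain_lengths_ge0 yzb.
case: xya a0 => [->|[l xy <-]] a0; first by rewrite (le_trans dle1)// lerDl.
case: yzb b0 => [->|[m yz <-]] b0; first by rewrite (le_trans dle1)// lerDr.
apply: chain_dist_le; right; exists (l ++ m); first exact: relprod_cat xy yz.
by rewrite /weight big_cat.
Qed.

Lemma chain_dist_block k x y : block k (x, y) -> chain_dist (x, y) <= k.+1%:R^-1.
Proof.
move=> xy; apply: chain_dist_le; right; exists [:: k].
  by apply/relprod_cons; exists y => //; exact/relprod_nil.
by rewrite /weight big_seq1.
Qed.

Lemma nbhs_block k x : nbhs x [set y | block k (x, y)].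
Proof.
have : forall m, nbhs x [set y | forall j, (j < m)%N -> S (pickle (k, j)) (x, y)].
  elim=> [|m IH]; first by apply: filterS filterT.
  apply: filterS2 IH (S_nbhs (pickle (k, m)) x) => y IH Sy j.
  by rewrite ltnS leq_eqVlt => /orP[/eqP->|/IH].
by move=> /(_ k.+1); apply: filterS => y.
Qed.

Lemma chain_dist_continuous : continuous chain_dist.
Proof.
move=> [x y]; apply/cvgrPdist_lt => e e0.
have [k ke] : exists k, k.+1%:R^-1 < e / 2 :> R.
  have e20 : 0 < (e / 2)^-1 by rewrite invr_gt0 divr_gt0.
  exists (Num.truncn (e / 2)^-1); rewrite -[ltRHS]invrK ltf_pV2 ?posrE//.
  by rewrite truncnS_gt.
exists ([set a | block k (x, a)], [set b | block k (y, b)]).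
  by split; exact: nbhs_block.
move=> [a b] /= [/chain_dist_block xa /chain_dist_block yb].
set r := k.+1%:R^-1 in ke xa yb.
have t1 := chain_dist_triangle x a y; have t2 := chain_dist_triangle a b y.
have t3 := chain_dist_triangle a x b; have t4 := chain_dist_triangle x y b.
rewrite (chain_dist_sym b) in t2; rewrite (chain_dist_sym a x) in t3.
rewrite ltr_norml.
apply/andP; split; lra.
Qed.

Lemma chain_dist_pseudometric : continuous_pseudometric chain_dist.
Proof.
split.
- exact: chain_dist_ge0.
- move=> x; apply/eqP; rewrite eq_le chain_dist_ge0 andbT.
  apply: chain_dist_le; right; exists [::]; first exact/relprod_nil.
  by rewrite /weight big_nil.
- exact: chain_dist_sym.
- exact: chain_dist_triangle.
- exact: chain_dist_continuous.
Qed.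

Lemma symmetric_perm_prod : universal_uniformity R X (perm_prod S).
Proof.
exists chain_dist; first exact: chain_dist_pseudometric.
move=> [x y] /= /(inf_lt (chain_lengths_neq0 x y))[_ [->|[l lxy <-]]].
  by rewrite ltxx.
by move=> /weight_lt1_perm_prod; apply.
Qed.

End chain_pseudometric.


Section pseudometric_balls.
Local Open Scope ring_scope.
Context {R : realType} {X : topologicalType}.
Variable d : X * X -> R.
Hypothesis d_pm : continuous_pseudometric d.

(** A product with distinct indices has length at most the sum of the
    c / 2^(n+1), which stays below c. *)
Lemma pseudometric_perm_prod (c : R) : 0 < c ->
  perm_prod (fun n => [set xy | d xy < c / 2 ^+ n.+1]) `<=` [set xy | d xy < c].
Proof.
have [_ d0 _ dtri _] := d_pm.
move=> c0 [x y] /perm_prodP[n [l [ln lxy]]] /=.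
have : d (x, y) <= \sum_(k <- l) c / 2 ^+ k.+1.
  elim: l x lxy {ln} => [|k l IH] x.
    by move=> /relprod_nil ->; rewrite big_nil d0.
  move=> /relprod_cons[z xz /IH zy]; rewrite big_cons.
  by apply: le_trans (dtri _ z _) _; apply: lerD => //; exact: ltW.
move=> /le_lt_trans; apply; rewrite (perm_big _ ln) /=.
suff -> : \sum_(k <- iota 0 n) c / 2 ^+ k.+1 = c - c / 2 ^+ n.
  by rewrite ltrBlDr ltrDl divr_gt0// exprn_gt0.
elim: n {ln} => [|n IH]; first by rewrite big_nil expr0 divr1 subrr.
rewrite -addn1 iotaD big_cat big_seq1 /= IH add0n addn1 exprS.
by field; rewrite expf_neq0.
Qed.

Lemma pseudometric_ball_nbhs (c : R) x : 0 < c -> nbhs x [set y | d (x, y) < c].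
Proof.
have [_ d0 _ _ dcont] := d_pm.
move=> c0; have /cvgrPdist_lt/(_ _ c0)[[A B] /= [Ax Bx] AB] := dcont (x, x).
apply: filterS Bx => y By; have := AB (x, y) (conj (nbhs_singleton Ax) By).
by rewrite /= d0 sub0r normrN; apply: le_lt_trans; exact: ler_norm.
Qed.

Lemma pseudometric_ball_qU (c : R) : 0 < c ->
  universal_quasi_uniformity X [set xy | d xy < c].
Proof.
move=> c0; exists (fun n => [set xy | d xy < c / 2 ^+ n.+1]).
  move=> n x; rewrite xsectionE; apply: pseudometric_ball_nbhs.
  by rewrite divr_gt0// exprn_gt0.
exact: pseudometric_perm_prod.
Qed.

End pseudometric_balls.

(** An index a codes the sequence of its rows, and the relation with index a is
    the permutation product of the symmetrized U at these rows. *)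
Lemma universal_uniformity_base (R : realType) (X : topologicalType) :
  has_omega_omega_base (universal_quasi_uniformity X) ->
  has_omega_omega_base (universal_uniformity R X).
Proof.
move=> [U [UqU Ubase Udec]].
pose row (a : nat -> nat) (n i : nat) := a (pickle (n, i)).
pose S a n := U (row a n) `|` [set xy | U (row a n) (xy.2, xy.1)].
exists (fun a => perm_prod (S a)); split.
- move=> a; apply: symmetric_perm_prod => [n x|n x y [?|?]]; [|by right|by left].
  by apply: filterS (qU_nbhs x (UqU (row a n))) => y; left.
- move=> A [d d_pm dA].
  have /choice[b bP] : forall n, exists b, U b `<=` [set xy | (d xy < 1 / 2 ^+ n.+1)%R].
    move=> n; apply: Ubase; apply: pseudometric_ball_qU => //.
  pose a m := if unpickle m is Some (n, i) then b n i else 0%N.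
  have aE n : row a n = b n by apply/funext => i; rewrite /row /a pickleK.
  exists a; apply: subset_trans dA.
  apply: subset_trans (pseudometric_perm_prod d_pm ltr01).
  apply: perm_prod_sub => n [x y] []; rewrite aE; first exact: bP.
  by have [_ _ dsym _ _] := d_pm; move=> /bP /=; rewrite dsym.
- move=> a b ab; apply: perm_prod_sub => n [x y].
  have sub : U (row b n) `<=` U (row a n) by apply: Udec => i; exact: ab.
  by move=> [/sub|/sub]; [left|right].
Qed.

(** * Separation of points *)
Section separation.
Context {X : topologicalType}.

Lemma closure_infinite (C : set X) x V : accessible_space X ->
  closure C x -> ~ C x -> nbhs x V -> infinite_set (V `&` C).
Proof.
move=> T1 Cx nCx Vx Vfin.
have VCc : closed (V `&` C) by exact: (accessible_finite_set_closed.1 T1).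
have VCx : nbhs x (V `&` ~` (V `&` C)).
  apply: filterI => //; apply: open_nbhs_nbhs.
  by split; [exact: closed_openC|move=> -[]].
by have [y [Cy [Vy nVCy]]] := Cx _ VCx; exact: nVCy.
Qed.

Lemma regular_open (x : X) W : regular_space X -> nbhs x W ->
  exists G, [/\ open G, G x & closure G `<=` W].
Proof.
move=> reg /reg[V Vx VW]; exists V^°; split; first exact: open_interior.
  exact: nbhs_singleton (nbhs_interior Vx).
by apply: subset_trans VW; apply: closure_subset; exact: interior_subset.
Qed.

(** Shrink the W n to neighborhoods with closure in W n, then subtract from each
    the closures of the previous ones. *)
Lemma disjoint_expansion (x : nat -> X) (W : nat -> set X) : regular_space X ->
  (forall n, nbhs (x n) (W n)) -> (forall n m, W n (x m) -> m = n) ->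
  exists O : nat -> set X, [/\ forall n, open (O n), forall n, O n (x n) &
    forall n m y, O n y -> O m y -> n = m].
Proof.
move=> reg Wx Wdisc.
have /choice[G GP] n := regular_open reg (Wx n).
exists (fun n => G n `&` ~` \bigcup_(i in [set i | (i < n)%N]) closure (G i)); split.
- move=> n; apply: openI; first by have [] := GP n.
  apply: closed_openC; rewrite bigcup_mkord; apply: closed_bigsetU => i _.
  exact: closed_closure.
- move=> n; split; first by have [] := GP n.
  move=> [i /= lin Gix]; have [_ _ GW] := GP i.
  by move: lin; rewrite (Wdisc i n (GW _ Gix)) ltnn.
move=> n m y [Gn nG] [Gm mG].
have [lt|lt|//] := ltngtP n m.
  by case: mG; exists n => //; exact: subset_closure.
by case: nG; exists m => //; exact: subset_closure.
Qed.

End separation.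

(** * Derived sets *)
Section quasi_uniformity_base.
Context {X : topologicalType}.
Variable U : (nat -> nat) -> set (X * X).
Hypothesis U_qU : forall a, universal_quasi_uniformity X (U a).
Hypothesis U_base : forall A, universal_quasi_uniformity X A ->
  exists a, U a `<=` A.
Hypothesis U_dec : forall a b, le_pt a b -> U b `<=` U a.
Hypothesis X_regular : regular_space X.
Hypothesis X_T1 : accessible_space X.

(** The points of D are countably many obstacles, and no neighborhood of x
    avoids all of them. *)
Lemma closure_common_point (D : set X) x a : countable D -> closure D x ->
  exists n d, D d /\ forall b, extends (mkseq a n) b -> U b (x, d).
Proof.
move=> /countable_injP[e einj] Dx.
pose Q n := [set b | forall d, D d -> e d = n -> ~ U b (x, d)].
have [n b c bc Qb d Dd den /(U_dec bc)|[b Qb]|n nQ] := @prefix_avoids Q _ _ a.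
- exact: Qb.
- have [d [Dd Ud]] := Dx _ (qU_nbhs x (U_qU b)).
  exact: (Qb (e d)) Ud.
have Qd b : extends (mkseq a n) b -> exists d, [/\ D d, e d = n & U b (x, d)].
  move=> /nQ Qb; apply: contrapT => /forallNP nd; apply: Qb => d Dd den Ud.
  exact: (nd d).
have [d [Dd den _]] := Qd a (extends_self a n).
exists n, d; split=> // b /Qd[d' [Dd' d'en Ud']].
by rewrite (einj d d') ?inE ?den.
Qed.

(** Let a_x be an index with U_(a_x) contained in the relation that keeps other
    points away from x.  If the closure is uncountable, condensation gives a
    point x and points v_n <> x such that a_(v_n) converges to a_x, and v_n is
    eventually in every set described by a prefix and a point of D that
    contains x.  By the first property the indices are bounded, so that x has a
    neighborhood without any v_n; regularity separates x from all v_n by disjoint open sets.  By the second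
    property, for every b, the sets U_b[x] and U_b[v_n] have a common point
    when n is large. *)
Lemma countable_closure (D : set X) : countable D -> countable (closure D).
Proof.
move=> Dc; apply: contrapT => Kuc.
have /choice[a aP] : forall x : X, exists a,
    U a `<=` same_forward (fun _ : unit => ~` [set x]).
  by move=> x; apply: U_base; apply: closed_qU; exact: accessible_closed_set1.
have /countable_injP[e einj] := Dc.
(* (s, None) describes the index of x; (s, Some k) describes which U_b[x], b
   extending s, all contain the point of D with code k *)
pose S (i : seq nat * option nat) := if i.2 is Some k
  then [set x | forall d, D d -> e d = k ->
                  forall b, extends i.1 b -> U b (x, d)]
  else [set x | extends i.1 (a x)].
have [x Kx [u [uP uS]]] := condensation S Kuc.
(* a subsequence along which the index of the n-th term agrees with a x on n
   values, as required for boundedness *)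
pose v n := u (n + pickle (mkseq (a x) n, None : option nat))%N.
have [c vc] : exists c, forall n, le_pt (a (v n)) c.
  apply: (@extending_bounded (a x)) => n.
  apply: (uS (mkseq (a x) n, None)); last exact: leq_addl.
  exact: extends_self.
have [G [Gop Gx GU]] := regular_open X_regular (qU_nbhs x (U_qU c)).
have vG n : ~ closure G (v n).
  move=> /GU /(U_dec (vc n)) /aP /(_ tt) /= vx.
  by apply: vx => // /esym; exact: (uP _).2.
pose O (i : bool) := if i then G else ~` closure G.
have O_qU : universal_quasi_uniformity X (same_forward O).
  apply: same_forward_qU => y; have [Gy|nGy] := pselect (closure G y).
    have [Gy'|nGy] := pselect (G y).
      apply: filterS (open_nbhs_nbhs (conj Gop Gy')) => z Gz [|] //.
    by apply: filterS filterT => z _ [|].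
  apply: filterS (open_nbhs_nbhs (conj (closed_openC (@closed_closure _ G)) nGy)).
  by move=> z nGz [] //= /subset_closure.
have [b bO] := U_base O_qU.
have [n [d [Dd xd]]] := closure_common_point b Dc Kx.
have Gd : G d := bO _ (xd b (extends_self b n)) true Gx.
pose N := pickle (mkseq b n, Some (e d)).
have /(_ d Dd erefl b (extends_self b n)) vd : S (mkseq b n, Some (e d)) (v N).
  apply: uS => /=; last exact: leq_addr.
  by move=> d' Dd' d'd; rewrite (einj d' d)// inE.
exact: (bO _ vd false (vG N) (subset_closure Gd)).
Qed.

(** Suppose X'^s is uncountable.  Using cofinality of all prefixes of one index,
    build countable closed sets F_0, G_0, F_1, G_1, and so on, each contained in
    the next one, such that the indices of the F_n are bounded.  Closures of
    countable sets being countable, each F_n misses a point x of any given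
    uncountable S s; the point c that U_b[x] meets for all b extending s is put
    into G_n.  The relation preserving the complements of all G_n then excludes
    the pair (x, c). *)
Lemma countable_countable_accumulation : countable (countable_accumulation X).
Proof.
apply: contrapT => Auc.
pose S (s : seq nat) := [set x | exists2 c, c <> x &
  forall b, extends s b -> U b (x, c)].
have AS a x : countable_accumulation X x -> exists n, S (mkseq a n) x.
  move=> [C [Cc Cx]].
  have [||n [c [[_ cx] Uc]]] := @closure_common_point (C `\ x) x a.
  - by apply: sub_countable Cc; apply: subset_card_le => y [].
  - move=> V Vx; apply: contrapT => /forallNP nV; apply: (Cx V Vx).
    apply: sub_finite_set (finite_set1 x) => y [Vy Cy].
    by apply: contrapT => yx; apply: (nV y).
  - by exists n, c.
pose good (F : set X) := countable F /\ closed F.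
have /choice[aF aFP] : forall F : set X, exists a, closed F ->
    U a `<=` same_forward (fun _ : unit => ~` F).
  move=> F; have [Fc|nFc] := pselect (closed F); last by exists id.
  by have [a aP] := U_base (closed_qU Fc); exists a.
have [||F0 [F0good F0cof]] := @cofinal_prefixes X good aF.
- by split; [exact: countable0|exact: closed0].
- move=> W gW; exists (closure (\bigcup_s W s)); last exact: subset_closure.
  split; last exact: closed_closure.
  apply: countable_closure; apply: bigcup_countable; first exact: countableP.
  by move=> s _; have [] := gW s.
(* one stage: from F_n to G_n and F_(n+1) *)
have /choice[g gP] : forall nF : nat * set X, exists GF : set X * set X,
    good nF.2 -> [/\ good GF.1 /\ good GF.2,
      extends (mkseq (aF F0) nF.1.+1) (aF GF.2), nF.2 `<=` GF.1, GF.1 `<=` GF.2 &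
      ~ countable (countable_accumulation X `&` S (decode_prefix nF.1)) -> exists x c,
        [/\ ~ GF.1 x, GF.1 c & forall b, extends (decode_prefix nF.1) b -> U b (x, c)] ].
  move=> [n F]; have [/= gF|] := pselect (good F); last by exists (set0, set0).
  suff [G [gG FG GP]] : exists G, [/\ good G, F `<=` G &
      ~ countable (countable_accumulation X `&` S (decode_prefix n)) -> exists x c,
        [/\ ~ G x, G c & forall b, extends (decode_prefix n) b -> U b (x, c)] ].
    have [F' [gF' GF' sF']] := F0cof n.+1 G gG.
    by exists (G, F') => _; split.
  have [suc|csS] := pselect (~ countable (countable_accumulation X `&` S (decode_prefix n)));
    last by exists F; split=> // /csS.
  have [x [Ax [c cx xc]] nFx] := uncountable_setD suc gF.1.
  exists (F `|` [set c]); split.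
  - split; last exact: closedU gF.2 (accessible_closed_set1 X_T1 (x := c)).
    exact: countable_setU gF.1 (countable1 c).
  - by left.
  by move=> _; exists x, c; split=> //; [move=> [//|/esym]|right].
pose Fs := fix Fs n := if n is m.+1 then (g (m, Fs m)).2 else F0.
pose Gs n := (g (n, Fs n)).1.
have gFs n : good (Fs n) by elim: n => //= n /(gP (n, _))[[]].
have GsP n := gP (n, Fs n) (gFs n).
have [c cP] : exists c, forall n, le_pt (aF (Fs n)) c.
  apply: (@extending_bounded (aF F0)) => -[|n]; first exact: extends_self.
  by have [] := GsP n.
have Gsub m n : (m <= n)%N -> Gs m `<=` Gs n.
  elim: n => [|n IH]; first by rewrite leqn0 => /eqP ->.
  rewrite leq_eqVlt => /orP[/eqP -> //|/IH]; move/subset_trans; apply.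
  have [_ _ _ GF _] := GsP n; have [_ _ FG _ _] := GsP n.+1.
  exact: subset_trans GF FG.
have V_qU : universal_quasi_uniformity X (same_forward (fun n => ~` Gs n)).
  apply: closed_chain_qU => // [n|y nGy].
    by have [[[]]] := GsP n.
  apply: filterS (qU_nbhs y (U_qU c)) => z yz n Gnz.
  have [_ _ _ GF _] := GsP n.
  have [_ _ FG _ _] := GsP n.+1.
  have /(_ tt) := aFP _ (gFs n.+1).2 _ (U_dec (cP n.+1) yz).
  by apply; [move=> /FG; exact: nGy|exact: GF].
have [b bV] := U_base V_qU.
have [n Sn] := uncountable_prefix Auc (AS b).
have [_ _ _ _] := GsP (pickle (mkseq b n)).
rewrite decode_prefixK => /(_ Sn)[x [d [nGx Gd xd]]].
exact: (bV _ (xd b (extends_self b n)) _ nGx Gd).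
Qed.

Lemma closed_countable_accumulation : closed (countable_accumulation X).
Proof.
move=> x Ax; apply: contrapT => nAx; apply: (nAx).
exists (countable_accumulation X); split.
  exact: countable_countable_accumulation.
by move=> V; exact: closure_infinite.
Qed.

(** Suppose uncountably many points outside X'^s are not P-points, and choose
    distinct points x_n among them, x_n in the n-th of the sets S s if
    uncountably many of them are in that set.  They have disjoint open
    neighborhoods, since none is an accumulation point of the others; these can
    be shrunk to be contained in the neighborhood of x_n that no U_b[x_n], b
    extending s, is contained in. *)
Lemma countable_non_P_points : countable (non_P_points X).
Proof.
apply: contrapT => Buc.
pose B := non_P_points X `\` countable_accumulation X.
have {}Buc : ~ countable B.
  move=> Bc; have [x Px] := uncountable_setD Buc
    (countable_setU Bc countable_countable_accumulation).
  by apply; have [|] := pselect (countable_accumulation X x); [right|left].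
have /choice[V VP] : forall x : X, exists V : nat -> set X, B x ->
    (forall n, nbhs x (V n)) /\ ~ nbhs x (\bigcap_n V n).
  move=> x; have [[/existsNP[V nV] _]|nB] := pselect (B x); last first.
    by exists (fun=> setT).
  by exists V => _; exact: (not_implyP _ _).1 nV.
pose S s := [set x | exists m, forall b, extends s b ->
  ~ [set y | U b (x, y)] `<=` V x m].
have BS a x : B x -> exists n, S (mkseq a n) x.
  move=> /VP[Vx nVx].
  pose Q n := [set b | [set y | U b (x, y)] `<=` V x n].
  have [n b c bc|[b Qb]|n nQ] := @prefix_avoids Q _ _ a.
  - by apply: subset_trans => y; exact: U_dec.
  - by apply: nVx; apply: filterS (qU_nbhs x (U_qU b)) => y Uy n _; exact: Qb.
  - by exists n, n.
have /choice[T TP] : forall n, exists T : set X, [/\ ~ countable T, T `<=` B &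
    ~ countable (B `&` S (decode_prefix n)) -> T `<=` S (decode_prefix n)].
  move=> n; have [suc|cS] := pselect (~ countable (B `&` S (decode_prefix n))).
    by exists (B `&` S (decode_prefix n)); split=> // _ x [].
  by exists B; split=> // /cS.
have [x xinj xT] := injective_choice (fun n => let: And3 Tuc _ _ := TP n in Tuc).
have xB n : B (x n) by have [_ TB _] := TP n; exact: TB (xT n).
have /choice[W WP] : forall n, exists W, nbhs (x n) W /\
    forall m, W (x m) -> m = n.
  move=> n; have [_ /forallNP/(_ (range x)) /not_andP[]] := xB n.
    case; apply: sub_countable (card_image_le _ _) _; exact: countableP.
  move=> /existsNP[N] /not_implyP[Nx /contrapT Nfin].
  exists (N `&` ~` ((N `&` range x) `\ x n)); split.
    apply: filterI => //; apply: open_nbhs_nbhs; split; last by move=> [_ /(_ erefl)].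
    apply: closed_openC; apply: (accessible_finite_set_closed.1 X_T1).
    exact: finite_setD.
  move=> m [Nm /= nm]; apply: xinj; apply: contrapT => mn; apply: nm; split=> //.
  by split=> //; exists m.
have [N [Nop Nx Ndis]] :=
  disjoint_expansion X_regular (fun n => (WP n).1) (fun n => (WP n).2).
have /choice[m mP] : forall n, exists m, ~ countable (B `&` S (decode_prefix n)) ->
    forall b, extends (decode_prefix n) b -> ~ [set y | U b (x n, y)] `<=` V (x n) m.
  move=> n; have [suc|] := pselect (~ countable (B `&` S (decode_prefix n))); last first.
    by exists 0%N.
  by have [_ _ /(_ suc _ (xT n))[m mP]] := TP n; exists m.
pose N' n := N n `&` (V (x n) (m n))^°.
have N'_qU : universal_quasi_uniformity X (same_forward N').
  apply: same_forward_qU => y.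
  have [[n Nny]|nN] := pselect (exists n, N' n y); last first.
    by apply: filterS filterT => z _ n Nny; case: nN; exists n.
  have N'op : open (N' n) by apply: openI (Nop n) _; exact: open_interior.
  apply: filterS (open_nbhs_nbhs (conj N'op Nny)) => z Nnz i Niy.
  by rewrite (Ndis i n y Niy.1 Nny.1).
have [b bN] := U_base N'_qU.
have [k Sk] := uncountable_prefix Buc (BS b).
pose n := pickle (mkseq b k); rewrite -(decode_prefixK (mkseq b k)) -/n in Sk.
apply: (mP n Sk b); first by rewrite decode_prefixK; exact: extends_self.
move=> y xy; apply: interior_subset; apply: (bN _ xy n _).2.
split; first exact: Nx.
by apply: nbhs_singleton; apply: nbhs_interior; exact: (VP _ (xB _)).1.
Qed.

(** For each countable set that does not contain it, a P-point has a
    neighborhood disjoint from that set. *)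
Lemma closed_non_P_points : closed (non_P_points X).
Proof.
move=> x Bx; apply: contrapT => nBx; have xP : P_point x by exact: contrapT nBx.
have /countable_injP[e einj] := countable_non_P_points.
suff nx : nbhs x (\bigcap_n [set z | non_P_points X z -> e z <> n]).
  by have [y [By /(_ (e y) I)]] := Bx _ nx; exact.
apply: xP => n.
have [[z [Bz ezn]]|nz] := pselect (exists z, non_P_points X z /\ e z = n); last first.
  by apply: filterS filterT => y _ By eyn; apply: nz; exists y.
have zx : x <> z by move=> xz; apply: nBx; rewrite xz.
apply: filterS (open_nbhs_nbhs (conj (closed_openC (accessible_closed_set1 X_T1 (x := z))) zx)).
by move=> y yz By eyn; apply: yz; apply: einj; rewrite ?inE// eyn.
Qed.

End quasi_uniformity_base.

Unset Implicit Arguments.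

Theorem theorem7p10 (R : realType) (X : topologicalType)
    (X_tychonoff : tychonoff_space X)
    (qU_base : has_omega_omega_base (universal_quasi_uniformity X)) :
  [/\ has_omega_omega_base (universal_uniformity R X),
      countable (countable_accumulation X) /\
        closed (countable_accumulation X)
    & card_lt omega1 frakb ->
        countable (non_P_points X) /\ closed (non_P_points X)].
Proof.
have [creg haus] := X_tychonoff.
have reg := @completely_regular_regular R X creg.
have T1 := hausdorff_accessible haus.
have [U [UqU Ubase Udec]] := qU_base.
split; first exact: universal_uniformity_base.
- split; first exact: (countable_countable_accumulation UqU Ubase Udec).
  exact: (closed_countable_accumulation UqU Ubase Udec).
- move=> _; split; first exact: (countable_non_P_points UqU Ubase Udec).
  exact: (closed_non_P_points UqU Ubase Udec).
Qed.
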